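(* For real $q,r>0$ define $\Omega^{(q,r)}:\mathbb{R}\to\mathbb{R}$ by $\Omega^{(q,r)}(x) := \frac{qr(e^{-qx}-e^{-rx})}{r-q}$ if $x>0$ and $q\ne r$; $\Omega^{(q,r)}(x) := r^2 x e^{-rx}$ if $x>0$ and $q = r$; and $\Omega^{(q,r)}(x) := 0$ if $x \le 0$. Fix an integer $p \geq 2$, subsets $X,Y\subset\mathbb{R}$ each of size at least $p$, and $q,r>0$. \begin{enumerate} \item If $\alpha \geq p-2$, then the kernel $(x,y)\mapsto \Omega^{(q,r)}(x-y)^\alpha$ is $\mathrm{TN}_p$ on $X\times Y$. \item There exists $a = a(X,Y)\in\mathbb{R}$ such that for every $\alpha\in(0,p-2)\setminus\mathbb{Z}$ the kernel $(x,y)\mapsto\Omega^{(q,r)}(x-y-a)^\alpha$ on $X\times Y$ is not $\mathrm{TN}_p$. \item Given $\mathbf{x},\mathbf{y}\in\operatorname{inc}(\mathbb{R},p)$, there exists $a\in\mathbb{R}$ such that for every $\alpha \ge 0$ the matrix $(\Omega^{(q,r)}(x_j-y_k-a)^\alpha)_{j,k=1}^p$ is $\mathrm{TP}$ if $\alpha>p-2$, $\mathrm{TN}$ if $\alpha\in\{0,1,\dots,p-2\}$, and not $\mathrm{TN}$ if $\alpha\in(0,p-2)\setminus\mathbb{Z}$. \end{enumerate}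
   Context: For a totally ordered set $X$ and integer $r \geq 1$, $\operatorname{inc}(X,r)$ denotes the set of $r$-tuples $(x_1,\dots,x_r) \in X^r$ with $x_1 < \cdots < x_r$. For $X,Y \subset \mathbb{R}$, a kernel $K : X \times Y \to \mathbb{R}$ is $\mathrm{TN}_p$ if $\det (K(x_j,y_k))_{j,k=1}^r \geq 0$ for all $1 \leq r \leq p$ and all $\mathbf{x} \in \operatorname{inc}(X,r)$, $\mathbf{y} \in \operatorname{inc}(Y,r)$. A real matrix is $\mathrm{TN}$/$\mathrm{TP}$ if all its minors are $\ge0$/$>0$. Convention: $0^0:=0$. *)

(* Defs.v *)
From HB Require Import structures.
From mathcomp Require Import all_boot all_order all_algebra.
From mathcomp Require Import reals.
From mathcomp Require Import sequences exp.
Set Implicit Arguments. Unset Strict Implicit. Unset Printing Implicit Defensive.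
Import Order.TTheory GRing.Theory Num.Theory.
Local Open Scope ring_scope.

Section Defs.
Variable R : realType.

Definition Omega (q r x : R) : R :=
  if 0 < x then
    (if q == r then r ^+ 2 * x * expR (- (r * x))
     else q * r * (expR (- (q * x)) - expR (- (r * x))) / (r - q))
  else 0.

(* real power with the paper's convention 0^0 := 0 (only used on a >= 0) *)
Definition rpow0 (a alpha : R) : R := if a == 0 then 0 else powR a alpha.

Definition incr {T : porderType ring_display} (r : nat) (x : 'I_r -> T) : Prop :=
  forall i j : 'I_r, (i < j)%N -> (x i < x j)%O.

Definition in_inc (X : R -> Prop) (r : nat) (x : 'I_r -> R) : Prop :=
  incr x /\ forall i, X (x i).

Definition has_card_ge (X : R -> Prop) (p : nat) : Prop :=
  exists f : 'I_p -> R, injective f /\ forall i, X (f i).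

Definition TN_kernel (p : nat) (X Y : R -> Prop) (K : R -> R -> R) : Prop :=
  forall (r : nat) (x y : 'I_r -> R), (1 <= r <= p)%N ->
    in_inc X x -> in_inc Y y ->
    0 <= \det (\matrix_(j, k) K (x j) (y k)).

Definition minor (n : nat) (A : 'M[R]_n) (r : nat) (f g : 'I_r -> 'I_n) : R :=
  \det (mxsub f g A).

Definition incr_idx (n r : nat) (f : 'I_r -> 'I_n) : Prop :=
  forall i j : 'I_r, (i < j)%N -> (f i < f j)%N.

Definition TN_mx (n : nat) (A : 'M[R]_n) : Prop :=
  forall (r : nat) (f g : 'I_r -> 'I_n), incr_idx f -> incr_idx g ->
    0 <= minor A f g.

Definition TP_mx (n : nat) (A : 'M[R]_n) : Prop :=
  forall (r : nat) (f g : 'I_r -> 'I_n), (1 <= r)%N -> incr_idx f -> incr_idx g ->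
    0 < minor A f g.

End Defs.

(* Main.v *)
Require Import Defs.
From HB Require Import structures.
From mathcomp Require Import all_boot all_order all_algebra.
From mathcomp Require Import ring lra zify.
From mathcomp Require Import boolp classical_sets functions reals topology normedtype.
From mathcomp Require Import derive realfun sequences exp.
Set Implicit Arguments. Unset Strict Implicit. Unset Printing Implicit Defensive.
Import Order.TTheory GRing.Theory Num.Theory.
Import numFieldNormedType.Exports.
Local Open Scope ring_scope.
Local Open Scope classical_set_scope.

(** Up to positive factors depending on [x] or on [y] only, [Omega q r (x - y)]
    is the positive part of [phi x - phi y] for some increasing [phi], so
    everything reduces to the kernels [max (0, u - v) ^ alpha].  For an
    [n x n] minor of such a kernel, factoring out the first column, differencing
    the rows and applying the mean value theorem to each row gives a positive
    multiple of [alpha ^ (n - 1)] times an [(n - 1) x (n - 1)] minor of exponent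
    [alpha - 1].  When all the differences [u_j - v_k] are positive, the minor is
    therefore a positive multiple of
    [\prod_(i < n) (alpha - i) ^ (n - 1 - i)], whose sign is positive for
    [alpha > n - 2], nonnegative for natural [alpha] and negative for
    [n - 3 < alpha < n - 2].  With truncation, the same recursion needs
    [alpha > 1] for differentiability, and the borderline [alpha = n - 2] follows
    by continuity in the exponent. *)

(** * Determinant identities over a commutative ring *)

Lemma cofactor_row' (R : comPzRingType) n (A B : 'M[R]_n) i k :
  row' i A = row' i B -> cofactor A i k = cofactor B i k.
Proof.
move=> AB; rewrite /cofactor; congr (_ * \det _).
by apply/matrixP => a b; move/matrixP: AB => /(_ a (lift k b)); rewrite !mxE.
Qed.

Lemma det_scale_rows_cols (R : comPzRingType) n (a b : 'I_n -> R) (A : 'M[R]_n) :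
  \det (\matrix_(i, j) (a i * b j * A i j))
  = (\prod_i a i) * (\prod_j b j) * \det A.
Proof.
have -> : \matrix_(i, j) (a i * b j * A i j)
    = diag_mx (\row_i a i) *m A *m diag_mx (\row_j b j).
  rewrite mul_diag_mx mul_mx_diag; apply/matrixP => i j.
  by rewrite !mxE mulrAC.
rewrite !det_mulmx !det_diag mulrAC; congr (_ * _ * _);
  by apply: eq_bigr => i _; rewrite mxE.
Qed.

(** Left multiplication by the unitriangular matrix [E], with -1 just below the diagonal, subtracts
    from each row its predecessor. The first column becomes (1, 0, ..., 0), and expanding along it
    leaves the row differences. *)
Lemma det_col0_row_diff (R : comPzRingType) n (N : 'M[R]_n.+1) :
  (forall i, N i ord0 = 1) ->
  \det N = \det (\matrix_(i < n, j < n)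
     (N (lift ord0 i) (lift ord0 j) - N (widen_ord (leqnSn n) i) (lift ord0 j))).
Proof.
move=> N0.
pose E := \matrix_(i < n.+1, k < n.+1)
  ((k == i)%:R - (i == k.+1 :> nat)%:R : R).
have detE : \det E = 1.
  rewrite det_trig; last first.
    apply/is_trig_mxP => i j ij; rewrite mxE.
    by rewrite -val_eqE /= gtn_eqF // ltn_eqF ?subr0 // ltnS ltnW.
  by apply: big1 => i _; rewrite mxE eqxx ltn_eqF ?subr0.
have EN i j : (E *m N) i j
    = N i j - \sum_(k < n.+1 | i == k.+1 :> nat) N k j.
  rewrite mxE; under eq_bigr do rewrite mxE mulrBl.
  rewrite sumrB; congr (_ - _).
    rewrite (bigD1 i) //= eqxx mul1r big1 ?addr0 // => k /negPf ->.
    by rewrite mul0r.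
  rewrite [RHS]big_mkcond; apply: eq_bigr => k _.
  by case: ifP => _; rewrite ?mul1r ?mul0r.
have EN0 j : (E *m N) ord0 j = N ord0 j by rewrite EN big1 ?subr0.
have ENS i j : (E *m N) (lift ord0 i) j
    = N (lift ord0 i) j - N (widen_ord (leqnSn n) i) j.
  by rewrite EN (big_pred1 (widen_ord (leqnSn n) i)).
rewrite -[LHS]mul1r -detE -det_mulmx (expand_det_col _ ord0) big_ord_recl /=.
rewrite big1 ?addr0 => [|i _]; last by rewrite ENS !N0 subrr mul0r.
rewrite EN0 N0 mul1r /cofactor expr0 mul1r; congr (\det _).
by apply/matrixP => i j; rewrite 2!mxE ENS mxE.
Qed.

(** * Mean value theorem and continuity for real determinants *)

Section RealDet.
Variable R : realType.
Implicit Types (n : nat) (a b : R).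

Lemma MVT_is_derive (f df : R -> R) a b : a < b ->
  (forall t, a <= t <= b -> is_derive t 1 f (df t)) ->
  exists2 c, a < c < b & f b - f a = (b - a) * df c.
Proof.
move=> ab fdf.
have [||c cab ->] := @MVT R f df a b ab.
- by move=> x; rewrite in_itv /= => /andP[/ltW ax /ltW xb]; apply: fdf; rewrite ax.
- apply: derivable_within_continuous => x; rewrite in_itv /= => xab.
  by have [] := fdf x xab.
by exists c; [rewrite in_itv in cab | rewrite mulrC].
Qed.

(* One row at a time: with the other rows frozen, the determinant is a linear
   combination of the entries of row [i], to which the scalar mean value
   theorem applies. *)
Lemma det_MVT n (F dF : 'I_n -> R -> R) (a b : 'I_n -> R) :
  (forall i, a i < b i) ->
  (forall i k t, a i <= t <= b i -> is_derive t 1 (F k) (dF k t)) ->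
  exists2 s : 'I_n -> R, (forall i, a i < s i < b i) &
    \det (\matrix_(i, k) (F k (b i) - F k (a i)))
    = (\prod_i (b i - a i)) * \det (\matrix_(i, k) dF k (s i)).
Proof.
move=> ab FdF.
(* Induction on the number [m] of leading rows already replaced by derivatives. *)
suff: forall m, (m <= n)%N -> exists2 s : 'I_n -> R, (forall i, a i < s i < b i) &
    \det (\matrix_(i, k) (F k (b i) - F k (a i)))
    = (\prod_(i < n | (i < m)%N) (b i - a i)) *
      \det (\matrix_(i, k) (if (i < m)%N then dF k (s i) else F k (b i) - F k (a i))).
  move=> /(_ n (leqnn n))[s sab ->]; exists s => //.
  congr (_ * _); first by apply: eq_bigl => i; rewrite ltn_ord.
  by congr determinant; apply/matrixP => i k; rewrite !mxE ltn_ord.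
elim=> [_|m IH mn].
  (* No row is replaced yet, so any interior point will do. *)
  exists (fun i => (a i + b i) / 2) => [i|]; first by have := ab i; lra.
  by rewrite big_pred0 ?mul1r.
have [s sab ->] := IH (ltnW mn).
pose i0 := Ordinal mn; set A := \matrix_(i, k) _.
have g' t : a i0 <= t <= b i0 ->
  is_derive t 1 (\sum_k (cofactor A i0 k \*: F k))
                (\sum_k (cofactor A i0 k *: dF k t)).
  move=> tab; apply: is_derive_sum => k; apply: is_deriveZ; exact: FdF tab.
have [c cab] := MVT_is_derive (ab i0) g'.
rewrite !fct_sumE -sumrB => gc.
exists (fun i => if i == i0 then c else s i) => [i|].
  by case: eqP => [->|].
rewrite [in RHS](bigD1 i0) ?leqnn //= -mulrA [RHS]mulrCA; congr (_ * _).
  by apply: eq_bigl => i; rewrite ltnS ltn_neqAle andbC.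
rewrite !(expand_det_row _ i0).
transitivity ((b i0 - a i0) * \sum_k cofactor A i0 k *: dF k c); last first.
  congr (_ * _); apply: eq_bigr => k _.
  rewrite mxE /= ltnSn eqxx /GRing.scale /= mulrC; congr (_ * _).
  (* The cofactors along row [i0] depend only on the other rows, on which the two matrices agree. *)
  apply: cofactor_row'; apply/matrixP => i j; rewrite !mxE.
  rewrite eq_sym (negPf (neq_lift _ _)) ltnS [in RHS]leq_eqVlt.
  have /negPf : lift i0 i != m :> nat by rewrite eq_sym; exact: (neq_lift i0 i).
  by move=> ->.
rewrite -gc; apply: eq_bigr => k _; rewrite mxE /= ltnn.
by rewrite mulrC mulrBr.
Qed.

Lemma continuous_det n (M : R -> 'M[R]_n) :
  (forall i j, continuous (fun t => M t i j)) -> continuous (fun t => \det (M t)).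
Proof.
move=> Mc; rewrite /determinant; apply: (continuous_big (@add_continuous R^o)) => s _ t.
apply: (cvgM (cvg_cst _)).
by apply: (continuous_big (@mul_continuous R)) => i _; exact: Mc.
Qed.

End RealDet.

(** * Increasing tuples and shifts *)

Section IncreasingTuples.
Variable R : realType.
Implicit Types (n m p : nat).

Lemma incr_ord_le n (x : 'I_n -> R) (i j : 'I_n) : incr x -> (i <= j)%N -> x i <= x j.
Proof.
move=> ix; rewrite leq_eqVlt => /orP[/eqP/val_inj ->//|ij].
exact/ltW/ix.
Qed.

Lemma incr_idx_comp n m (x : 'I_n -> R) (f : 'I_m -> 'I_n) :
  incr x -> incr_idx f -> incr (x \o f).
Proof. by move=> ix jf i j ij; apply/ix/jf. Qed.

Lemma incr_idx_leq n m (f : 'I_m -> 'I_n) : incr_idx f -> (m <= n)%N.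
Proof.
move=> jf; have /leq_card : injective f; last by rewrite !card_ord.
move=> i j fij; apply: val_inj; by case: (ltngtP i j) => // /jf; rewrite fij ltnn.
Qed.

Lemma has_card_ge_inc (X : R -> Prop) p : has_card_ge X p ->
  exists x : 'I_p -> R, in_inc X x.
Proof.
case=> f [injf Xf]; pose s := sort <=%R (codom f).
have ss : size s = p by rewrite size_sort size_codom card_ord.
have sX t : t \in s -> X t by rewrite mem_sort => /codomP[i ->].
have lt_s : sorted <%R s.
  by rewrite sort_lt_sorted map_inj_uniq ?enum_uniq.
exists (fun i => nth 0 s i); split=> [i j ij|i]; last by apply/sX/mem_nth; rewrite ss.
by apply: (sorted_ltn_nth lt_trans) => //; rewrite inE ss.
Qed.

(** Such a shift makes every [x j - y k - a] positive, so that no entry of the matrix is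
    truncated. *)
Lemma exists_shift p (x y : 'I_p -> R) : exists a, forall j k, y k + a < x j.
Proof.
have le_sum (z : 'I_p -> R) i : `|z i| <= \sum_j `|z j|.
  by rewrite (bigD1 i) //= lerDl sumr_ge0.
exists (- (\sum_j `|x j|) - (\sum_j `|y j|) - 1) => j k.
have := le_sum x j; have := le_sum y k.
have := ler_norm (y k); have := ler_norm (- x j); rewrite normrN; lra.
Qed.

End IncreasingTuples.

(** * Determinants of truncated power kernels *)

Section TruncatedPower.
Variable R : realType.
Implicit Types (n : nat) (a c t w alpha : R).

(** The test on [a] forces the value 0 at [a <= 0] even for [alpha = 0], where [powR 0 0] is 1; this
    agrees with the convention 0^0 = 0. *)
Definition tpow a alpha : R := if 0 < a then powR a alpha else 0.

Lemma tpow_le0 a alpha : a <= 0 -> tpow a alpha = 0.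
Proof. by rewrite /tpow; case: ltP. Qed.

Lemma tpow_ge0 a alpha : 0 <= tpow a alpha.
Proof. by rewrite /tpow; case: ltP => // _; rewrite powR_ge0. Qed.

Lemma tpowM c a alpha : 0 < c -> tpow (c * a) alpha = powR c alpha * tpow a alpha.
Proof.
move=> c0; rewrite /tpow pmulr_rgt0 //; case: ltP => a0; last by rewrite mulr0.
by rewrite powRM // ltW.
Qed.

Lemma continuous_tpow_exponent a : continuous (fun alpha => tpow a alpha).
Proof.
move=> alpha; rewrite /tpow; case: ltP => a0; last exact: cvg_cst.
rewrite /powR gt_eqF //.
have ca : {for alpha, continuous (fun x : R => x * ln a)} by apply: cvgMr_tmp; exact: cvg_id.
exact: (continuous_comp ca (@continuous_expR R _)).
Qed.

(** Only [a = 0] is delicate: there the difference quotient is [tpow h (alpha - 1)], which tends to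
    0 from both sides because [alpha > 1]. *)
Lemma is_derive_tpow a alpha : 0 < a \/ 1 < alpha ->
  is_derive a 1 (fun x => tpow x alpha) (alpha * tpow a (alpha - 1)).
Proof.
move=> a_alpha; case: (ltrgtP a 0) a_alpha => [a0 _|a0 _|-> [|alpha1]]; last 1 first.
- rewrite (tpow_le0 _ (lexx 0)) mulr0.
  have dq : h^-1 *: (tpow (h *: 1 + 0) alpha - tpow 0 alpha) @[h --> 0^'] --> (0 : R).
    rewrite (tpow_le0 alpha (lexx 0)).
    apply: (@cvg_trans _ (tpow h (alpha - 1) @[h --> 0^'])).
      apply: near_eq_cvg; near=> h.
      rewrite subr0 addr0 /GRing.scale /= mulr1 /tpow; case: ltP => h0.
        have alpha0 : 0 < alpha := lt_trans ltr01 alpha1.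
        by rewrite -(mulr_powRB1 (ltW h0) alpha0) mulKf ?gt_eqF.
      by rewrite mulr0.
    apply: (@cvg_at_right_left_dnbhs _ R^o).
      apply: (@cvg_trans _ (powR h (alpha - 1) @[h --> 0^'+])).
        by apply: near_eq_cvg; near=> h; rewrite /tpow ifT.
      by apply: powR_cvg0; lra.
    apply: (@cvg_trans _ ((cst 0 : R -> R) h @[h --> 0^'-])).
      by apply: near_eq_cvg; near=> h; rewrite tpow_le0.
    exact: cvg_cst.
  apply: DeriveDef; first by apply/cvg_ex; exists 0.
  exact: cvg_lim.
- rewrite tpow_le0 ?mulr0 ?ltW //.
  apply: (@near_eq_is_derive _ _ _ (cst (0 : R))).
  by near=> x; rewrite tpow_le0 //; apply: ltW; near: x; exact: lt_nbhsl.
- rewrite [X in _ * X]/tpow a0; have := is_derive1_powR alpha a0.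
  apply: near_eq_is_derive.
  by near=> x; rewrite /tpow ifT //; near: x; exact: lt_nbhsr.
- by [].
Unshelve. all: by end_near. Qed.

Lemma is_derive_tpow_shift w t alpha : 0 < t - w \/ 1 < alpha ->
  is_derive t 1 (fun x => tpow (x - w) alpha) (alpha * tpow (t - w) (alpha - 1)).
Proof.
move=> tw; rewrite -[X in is_derive _ _ _ X]mulr1.
exact: (@is_derive1_comp _ (fun x => tpow x alpha) (shift (- w)) _ _ _
  (is_derive_tpow tw) (is_derive_shift _ _ _)).
Qed.

(* With [t_j = 1 / (u_j - v_0)] and [w_k = v_k - v_0] one has
   [u_j - v_k = (u_j - v_0) w_k (1 / w_k - t_j)] for [k > 0]: dividing row [j]
   by the [alpha]-th power of [u_j - v_0] makes the first column constant, and
   differencing the rows lowers both the size and the exponent by one.  The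
   signs below make the new nodes increasing. *)
Lemma det_tpow_step n (u v : 'I_n.+1 -> R) alpha : incr u -> incr v ->
  v ord0 < u ord0 -> 1 < alpha \/ (forall j k, v k < u j) ->
  exists c (s w : 'I_n -> R), [/\ 0 < c, incr s, incr w,
    (forall j k, v k < u j) -> forall j k, w k < s j &
    \det (\matrix_(j, k) tpow (u j - v k) alpha)
    = c * alpha ^+ n * \det (\matrix_(j, k) tpow (s j - w k) (alpha - 1))].
Proof.
move=> iu iv vu0 hyp.
have vu j : 0 < u j - v ord0.
  rewrite subr_gt0; apply: lt_le_trans vu0 _.
  case: (unliftP ord0 j) => [i|] -> //; exact/ltW/iu.
have vv (k : 'I_n) : 0 < v (lift ord0 k) - v ord0.
  by rewrite subr_gt0; exact: iv.
pose z j := - (u j - v ord0)^-1.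
pose w (k : 'I_n) := - (v (lift ord0 k) - v ord0)^-1.
pose A j := powR (u j - v ord0) alpha.
(* Column 0 is treated apart, since the formula for [w] would invert [v ord0 - v ord0]; its entries
   are entirely absorbed by [A]. *)
pose B k := oapp (fun k' => powR (v (lift ord0 k') - v ord0) alpha) 1 (unlift ord0 k).
pose N := \matrix_(j < n.+1, k < n.+1)
  (oapp (fun k' => tpow (z j - w k') alpha) 1 (unlift ord0 k)).
have iz : incr z.
  by move=> i j ij; rewrite ltrN2 ltf_pV2 ?posrE // ltrD2r; exact: iu.
have iw : incr w.
  by move=> i j ij; rewrite ltrN2 ltf_pV2 ?posrE // ltrD2r; exact: iv.
have zw (j : 'I_n.+1) k : u j - v (lift ord0 k)
    = (u j - v ord0) * (v (lift ord0 k) - v ord0) * (z j - w k).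
  rewrite /z /w; field.
  by rewrite !gt_eqF.
have wz j k : v (lift ord0 k) < u j -> w k < z j.
  by rewrite -subr_gt0 zw pmulr_rgt0 ?subr_gt0 // mulr_gt0.
have -> : \matrix_(j, k) tpow (u j - v k) alpha = \matrix_(j, k) (A j * B k * N j k).
  apply/matrixP => j k; rewrite !mxE /B.
  case: unliftP => [k'|] -> /=; last by rewrite /tpow vu !mulr1.
  by rewrite zw tpowM ?mulr_gt0 // powRM ?ltW.
rewrite det_scale_rows_cols det_col0_row_diff; last first.
  by move=> i; rewrite mxE unlift_none.
pose lo (i : 'I_n) := z (widen_ord (leqnSn n) i).
pose hi (i : 'I_n) := z (lift ord0 i).
have lohi i : lo i < hi i by apply: iz; rewrite /= /bump /= add1n.
have FdF (i k : 'I_n) t : lo i <= t <= hi i ->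
    is_derive t 1 (fun x => tpow (x - w k) alpha)
              (alpha * tpow (t - w k) (alpha - 1)).
  move=> /andP[lot _]; apply: is_derive_tpow_shift.
  case: hyp => [|pos]; [by right|left].
  rewrite subr_gt0; apply: lt_le_trans lot; exact/wz/pos.
have [s sab Es] := det_MVT lohi FdF.
exists ((\prod_i A i) * (\prod_i B i) * \prod_i (hi i - lo i)), s, w; split => //.
- rewrite !mulr_gt0 // prodr_gt0 // => i _; rewrite ?subr_gt0 //.
    exact: powR_gt0.
  by rewrite /B; case: unliftP => [k|] _ //=; exact: powR_gt0.
(* The [s i] lie strictly inside the consecutive intervals between neighbouring values of [z], hence
   they increase. *)
- move=> i j ij.
  have /andP[_ /lt_le_trans] := sab i; apply.
  have /andP[/ltW + _] := sab j; apply: le_trans.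
  case: (ltngtP i.+1 j) => [lt|lt|eq].
  + by apply/ltW/iz; rewrite /= /bump /= add1n.
  + by move: lt; rewrite ltnS leqNgt ij.
  + rewrite /lo /hi le_eqVlt; apply/orP; left; apply/eqP; congr z.
    by apply: val_inj; rewrite /= /bump /= add1n.
- move=> pos j k; have /andP[+ _] := sab j; apply: lt_trans; exact/wz/pos.
rewrite -!mulrA; do 2![congr (_ * _)].
transitivity (\det (\matrix_(i, k) (tpow (hi i - w k) alpha - tpow (lo i - w k) alpha))).
  congr determinant; apply/matrixP => i k; rewrite !mxE.
  by rewrite liftK.
rewrite Es; congr (_ * _); rewrite -detZ; congr determinant.
by apply/matrixP => i k; rewrite !mxE.
Qed.

(** Iterate the reduction step: its [i]-th use meets size [n - i] and exponent [alpha - i], and so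
    contributes [(alpha - i) ^ (n - i - 1)]. *)
Lemma det_tpow_prod n (u v : 'I_n -> R) alpha : incr u -> incr v ->
  (forall j k, v k < u j) -> exists2 c, 0 < c &
  \det (\matrix_(j, k) tpow (u j - v k) alpha)
  = c * \prod_(i < n) (alpha - i%:R) ^+ (n - i.+1).
Proof.
elim: n u v alpha => [|n IH] u v alpha iu iv vu.
  by exists 1; rewrite // det_mx00 big_ord0 mulr1.
have [c [s [w [c0 si iw ws ->]]]] := det_tpow_step (alpha := alpha) iu iv (vu _ _) (or_intror vu).
have [d d0 ->] := IH s w (alpha - 1) si iw (ws vu).
exists (c * d); first exact: mulr_gt0.
rewrite big_ord_recl subr0 subn1 /= -!mulrA; congr (_ * _).
rewrite mulrCA; congr (_ * (_ * _)); apply: eq_bigr => i _.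
by rewrite /bump /= add1n subSS -addrA -opprD nat1r.
Qed.

(** Size and exponent drop together, so the bound is preserved by the recursion. From size 3 on it
    gives [alpha > 1], which the reduction step needs under truncation; sizes up to 2 are done by
    hand. *)
Lemma det_tpow_ge0_strict n (u v : 'I_n -> R) alpha : incr u -> incr v ->
  n%:R - 2 < alpha -> 0 <= \det (\matrix_(j, k) tpow (u j - v k) alpha).
Proof.
case: n u v => [|n] u v; first by rewrite det_mx00.
elim: n u v alpha => [|n IH] u v alpha iu iv alphan.
  by rewrite det_mx11 mxE tpow_ge0.
(* If [u ord0 <= v ord0], the whole first row is truncated to 0. *)
have [uv|vu] := leP (u ord0) (v ord0).
  rewrite (expand_det_row _ ord0) big1 // => k _.
  rewrite mxE tpow_le0 ?mul0r // subr_le0 (le_trans uv) //.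
  exact: incr_ord_le.
(* In size 2, either the upper right entry vanishes and the determinant is the product of the
   diagonal, or no entry is truncated and the product formula applies. *)
case: n IH u v iu iv alphan vu => [_|n IH] u v iu iv alphan vu.
  have alpha0 : 0 < alpha by move: alphan; rewrite subrr.
  have [uv|vu1] := leP (u ord0) (v ord_max).
    rewrite (expand_det_row _ ord0) !big_ord_recl big_ord0 /= addr0.
    rewrite [X in _ + X * _]mxE [X in _ + X * _]tpow_le0 ?mul0r ?addr0; last first.
      by rewrite subr_le0 (le_trans uv) // incr_ord_le.
    rewrite mxE mulr_ge0 ?tpow_ge0 // /cofactor expr0 mul1r det_mx11 !mxE.
    exact: tpow_ge0.
  have [|c c0 ->] := det_tpow_prod alpha iu iv.
    move=> j k; rewrite (@le_lt_trans _ _ (v ord_max)) ?incr_ord_le ?leq_ord //.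
    by rewrite (lt_le_trans vu1) // incr_ord_le.
  rewrite !big_ord_recl big_ord0 /= subr0 subnn expr0 !mulr1.
  by rewrite mulr_ge0 ?exprn_ge0 // ltW.
have alpha1 : 1 < alpha.
  apply: le_lt_trans alphan; rewrite -[n.+3]addn3 natrD.
  by have := ler0n R n; lra.
have [c [s [w [c0 si iw _ ->]]]] := det_tpow_step iu iv vu (or_introl alpha1).
apply: mulr_ge0.
  by apply: mulr_ge0; [exact: ltW|apply: exprn_ge0; lra].
by apply: IH => //; move: alphan; rewrite -[n.+3]addn1 natrD; lra.
Qed.

Lemma det_tpow_ge0 n (u v : 'I_n -> R) alpha : incr u -> incr v ->
  n%:R - 2 <= alpha -> 0 <= \det (\matrix_(j, k) tpow (u j - v k) alpha).
Proof.
move=> iu iv alphan.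
pose D b := \det (\matrix_(j < n, k < n) tpow (u j - v k) b).
have cD : {for alpha, continuous D}.
  apply: continuous_det => i j b.
  rewrite (_ : (fun _ => _) = tpow (u i - v j)); last by apply/funext => t; rewrite mxE.
  exact: continuous_tpow_exponent.
(* Exponents to the right of [alpha] satisfy the strict bound. *)
have cD' : D b @[b --> alpha^'+] --> D alpha by exact: cvg_at_right_filter.
apply: (cvgr_to_ge cD').
near=> b; apply: det_tpow_ge0_strict => //.
by apply: le_lt_trans alphan _; near: b; exact: nbhs_right_gt.
Unshelve. all: by end_near. Qed.

End TruncatedPower.

(** * Transfer from truncated powers to powers of [Omega] *)

Section OmegaKernel.
Variables (R : realType) (q r : R).
Hypotheses (q0 : 0 < q) (r0 : 0 < r).

(* For [q <> r], [phi x = exp ((r - q) x) / (r - q)]; it is increasing whatever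
   the sign of [r - q]. *)
Lemma Omega_factor : exists phi A B : R -> R,
  [/\ {homo phi : x y / x < y}, forall x, 0 < A x, forall y, 0 < B y &
   forall x y, Omega q r (x - y) = if y < x then A x * B y * (phi x - phi y) else 0].
Proof.
have [qr|qr] := eqVneq q r.
  exists id, (fun x => r ^+ 2 * expR (- (r * x))), (fun y => expR (r * y)).
  split => [//|x|y|x y]; rewrite ?mulr_gt0 ?exprn_gt0 ?expR_gt0 //.
  rewrite /Omega subr_gt0 qr eqxx; case: ifP => // _.
  have -> : expR (- (r * (x - y))) = expR (- (r * x)) * expR (r * y).
    by rewrite -expRD; congr expR; ring.
  by rewrite /=; ring.
have d0 : r - q != 0 by rewrite subr_eq0 eq_sym.
exists (fun x => expR ((r - q) * x) / (r - q)),
  (fun x => q * r * expR (- (r * x))), (fun y => expR (q * y)).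
split=> [x y xy|x|y|x y]; rewrite ?mulr_gt0 ?expR_gt0 //.
  case: (ltrgtP (r - q) 0) d0 => [d0|d0|//] _.
  - by rewrite ltr_nM2r ?invr_lt0 // ltr_expR ltr_nM2l.
  - by rewrite ltr_pM2r ?invr_gt0 // ltr_expR ltr_pM2l.
rewrite /Omega subr_gt0 (negPf qr); case: ifP => // _.
have -> : expR (- (q * (x - y))) = expR (- (r * x)) * expR (q * y) * expR ((r - q) * x).
  by rewrite -!expRD; congr expR; ring.
have -> : expR (- (r * (x - y))) = expR (- (r * x)) * expR (q * y) * expR ((r - q) * y).
  by rewrite -!expRD; congr expR; ring.
by field.
Qed.

(** The positive factors of [Omega_factor], raised to the power [alpha], come out of the rows and
    columns. A single [phi] serves all sizes, tuples and exponents. *)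
Lemma det_rpow0_Omega : exists2 phi : R -> R, {homo phi : x y / x < y} &
  forall n (x y : 'I_n -> R) alpha, exists2 c, 0 < c &
  \det (\matrix_(j, k) rpow0 (Omega q r (x j - y k)) alpha)
  = c * \det (\matrix_(j, k) tpow (phi (x j) - phi (y k)) alpha).
Proof.
have [phi [A [B [phi_incr A0 B0 OE]]]] := Omega_factor.
exists phi => // n x y alpha.
exists ((\prod_i powR (A (x i)) alpha) * \prod_i powR (B (y i)) alpha).
  by rewrite mulr_gt0 // prodr_gt0 // => i _; exact: powR_gt0.
rewrite -det_scale_rows_cols; congr determinant; apply/matrixP => j k.
rewrite !mxE OE /rpow0; case: ltP => [yx|xy].
  have xy0 : 0 < phi (x j) - phi (y k) by rewrite subr_gt0 phi_incr.
  by rewrite gt_eqF ?mulr_gt0 // /tpow xy0 !powRM // ?mulr_ge0 ?ltW.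
by rewrite eqxx tpow_le0 ?mulr0 // subr_le0 (ltW_homo phi_incr).
Qed.

Lemma det_Omega_ge0 n (x y : 'I_n -> R) alpha : incr x -> incr y ->
  n%:R - 2 <= alpha ->
  0 <= \det (\matrix_(j, k) rpow0 (Omega q r (x j - y k)) alpha).
Proof.
move=> ix iy alphan; have [phi phi_incr DE] := det_rpow0_Omega.
have [c c0 ->] := DE n x y alpha; rewrite mulr_ge0 ?(ltW c0) //.
by apply: (@det_tpow_ge0 _ _ (phi \o x) (phi \o y)) => // i j ij;
  apply: phi_incr; [exact: ix|exact: iy].
Qed.

Lemma det_Omega_prod n (x y : 'I_n -> R) a alpha : incr x -> incr y ->
  (forall j k, y k + a < x j) -> exists2 c, 0 < c &
  \det (\matrix_(j, k) rpow0 (Omega q r (x j - y k - a)) alpha)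
  = c * \prod_(i < n) (alpha - i%:R) ^+ (n - i.+1).
Proof.
move=> ix iy yx; have [phi phi_incr DE] := det_rpow0_Omega.
have [c c0 cE] := DE n x (fun k => y k + a) alpha.
have [||j k|d d0 dE] :=
  @det_tpow_prod R n (fun j => phi (x j)) (fun k => phi (y k + a)) alpha.
- by move=> i j ij; apply/phi_incr/ix.
- by move=> i j ij; apply: phi_incr; rewrite ltrD2r; exact: iy.
- exact/phi_incr.
exists (c * d); first exact: mulr_gt0.
rewrite -mulrA -dE -cE; congr determinant; apply/matrixP => j k.
by rewrite !mxE opprD addrA.
Qed.

End OmegaKernel.

(** * Sign of the product in the exponent *)

Section ExponentProduct.
Variable R : realType.
Implicit Types (alpha : R) (n p : nat).

Lemma exponent_prod_gt0 n alpha : n%:R - 2 < alpha ->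
  0 < \prod_(i < n) (alpha - i%:R) ^+ (n - i.+1).
Proof.
move=> alphan; apply: prodr_gt0 => i _.
have [lt|ge] := ltnP i.+1 n; last first.
  by rewrite (eqP (_ : n - i.+1 == 0)%N) ?expr0 // subn_eq0.
apply: exprn_gt0; rewrite subr_gt0; apply: le_lt_trans alphan.
by rewrite lerBrDr -natrD ler_nat addn2.
Qed.

(** If [m + 1 < n], the factor at [i = m] is a positive power of 0; otherwise every base is
    nonnegative. *)
Lemma exponent_prod_nat_ge0 n m :
  0 <= \prod_(i < n) ((m%:R : R) - i%:R) ^+ (n - i.+1).
Proof.
have [lt|ge] := ltnP m.+1 n; last first.
  apply: prodr_ge0 => i _; apply: exprn_ge0; rewrite subr_ge0 ler_nat.
  by rewrite -ltnS (leq_trans (ltn_ord i)).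
by rewrite (bigD1 (Ordinal (ltnW lt))) //= subrr expr0n subn_eq0 leqNgt lt mul0r.
Qed.

Lemma exponent_prod_lt0 p alpha : 0 < alpha -> alpha < (p - 2)%:R ->
  ~ (exists m : int, alpha = m%:~R) -> exists n,
  (1 <= n <= p)%N /\ \prod_(i < n) (alpha - i%:R) ^+ (n - i.+1) < 0.
Proof.
move=> alpha0 alphap alphaZ.
have /andP[kle klt] := truncn_itv (ltW alpha0).
set k := Num.truncn alpha in kle klt.
have {}kle : k%:R < alpha.
  rewrite lt_neqAle kle andbT; apply/eqP => kE.
  by apply: alphaZ; exists k%:Z; rewrite -kE.
(* With [k < alpha < k + 1] and size [k + 3], the factor at [i = k + 2] has exponent 0, the one at
   [i = k + 1] is negative with exponent 1, and all others are positive. *)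
exists k.+3; split.
  have : (k < p - 2)%N by rewrite -(ltr_nat R); exact: lt_trans alphap.
  lia.
rewrite !big_ord_recr /= subnn expr0 mulr1 subSS subSnn expr1.
rewrite pmulr_rlt0 ?subr_lt0 //.
rewrite mulr_gt0 ?exprn_gt0 ?subr_gt0 // prodr_gt0 // => i _.
rewrite exprn_gt0 // subr_gt0; apply: le_lt_trans kle.
by rewrite ler_nat ltnW.
Qed.

End ExponentProduct.

(** * Derivation of the three claims from the sign of minors of size at most [p] *)

Theorem mainTheorem10 (R : realType) (p : nat) (X Y : R -> Prop) (q r : R) :
  (2 <= p)%N -> has_card_ge X p -> has_card_ge Y p -> 0 < q -> 0 < r ->
  (* (1) *)
  (forall alpha : R, (p - 2)%:R <= alpha ->
     TN_kernel p X Y (fun x y => rpow0 (Omega q r (x - y)) alpha))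
  /\
  (* (2) *)
  (exists a : R, forall alpha : R,
     0 < alpha -> alpha < (p - 2)%:R -> ~ (exists n : int, alpha = n%:~R) ->
     ~ TN_kernel p X Y (fun x y => rpow0 (Omega q r (x - y - a)) alpha))
  /\
  (* (3) *)
  (forall x y : 'I_p -> R, incr x -> incr y ->
     exists a : R, forall alpha : R, 0 <= alpha ->
       let M := \matrix_(j, k) rpow0 (Omega q r (x j - y k - a)) alpha in
       ((p - 2)%:R < alpha -> TP_mx M) /\
       ((exists n : nat, (n <= p - 2)%N /\ alpha = n%:R) -> TN_mx M) /\
       (0 < alpha -> alpha < (p - 2)%:R -> ~ (exists n : int, alpha = n%:~R) ->
          ~ TN_mx M)).
Proof.
move=> p2 Xp Yp q0 r0.
have np2 n : (n <= p)%N -> n%:R - 2 <= (p - 2)%:R :> R.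
  by move=> np; rewrite natrB // lerB // ler_nat.
have [x0 [ix0 Xx0]] := has_card_ge_inc Xp.
have [y0 [iy0 Yy0]] := has_card_ge_inc Yp.
split; [|split].
- move=> alpha alphap n x y /andP[_ np] [ix _] [iy _].
  apply: det_Omega_ge0 => //; exact: le_trans (np2 n np) alphap.
- have [a yx] := exists_shift x0 y0; exists a => alpha alpha0 alphap alphaZ TN.
  have [n [np neg]] := exponent_prod_lt0 alpha0 alphap alphaZ.
  have np' : (n <= p)%N by case/andP: np.
  (* The violating minor uses the first [n] points of each tuple. *)
  have inc_w : incr_idx (widen_ord np') by [].
  have ix := incr_idx_comp ix0 inc_w; have iy := incr_idx_comp iy0 inc_w.
  have [c c0 cE] := det_Omega_prod q0 r0 alpha ix iy (fun j k => yx _ _).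
  have := TN n _ _ np (conj ix (fun i => Xx0 _)) (conj iy (fun i => Yy0 _)).
  by rewrite cE leNgt pmulr_rlt0 // neg.
- move=> x y ix iy; have [a yx] := exists_shift x y; exists a => alpha _ M.
  have minorE n (f g : 'I_n -> 'I_p) : incr_idx f -> incr_idx g ->
      exists2 c, 0 < c & minor M f g = c * \prod_(i < n) (alpha - i%:R) ^+ (n - i.+1).
    move=> jf jg.
    have [c c0 cE] := det_Omega_prod q0 r0 alpha
      (incr_idx_comp ix jf) (incr_idx_comp iy jg) (fun j k => yx _ _).
    exists c => //; rewrite -cE; congr determinant.
    by apply/matrixP => i j; rewrite !mxE.
  split=> [alphap n f g _ jf jg|]; [|split=> [[m [_ alphaE]] n f g jf jg|]].
  + have [c c0 ->] := minorE n f g jf jg.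
    rewrite mulr_gt0 // exponent_prod_gt0 //.
    exact: le_lt_trans (np2 n (incr_idx_leq jf)) alphap.
  + have [c c0 ->] := minorE n f g jf jg.
    by rewrite mulr_ge0 ?(ltW c0) // alphaE exponent_prod_nat_ge0.
  move=> alpha0 alphap alphaZ TN.
  have [n [/andP[_ np] neg]] := exponent_prod_lt0 alpha0 alphap alphaZ.
  have inc_w : incr_idx (widen_ord np) by [].
  have [c c0 cE] := minorE n _ _ inc_w inc_w.
  by have := TN n _ _ inc_w inc_w; rewrite cE leNgt pmulr_rlt0 // neg.
Qed.
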